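(* Let $A_1,A_2,\ldots,A_k\in\mathbb{C}^{n\times n}$ be pairwise commuting matrices. Then the matrix polynomial $\sum_{i=1}^kA_i\lambda^{i-1}$ is singular if and only if $(0,0,\ldots,0)\in\sigma_T(A_1,A_2,\ldots,A_k)$.
   Context: A matrix polynomial $P(\lambda)=\sum_{i=1}^k A_i\lambda^{i-1}$ is singular if $P(\lambda_0)$ is not invertible for every $\lambda_0\in\mathbb{C}$. Taylor spectrum: let $\mathcal{H}$ be a complex Hilbert space (here $\mathcal{H}=\mathbb{C}^n$). Let $\Lambda[s]$ be the free complex algebra generated by indeterminates $s_1,\ldots,s_k$ with product $\wedge$ satisfying $s_i\wedge s_j=-s_j\wedge s_i$ (the exterior algebra). For $F=\{i_1<\ldots<i_p\}\subset\{1,\ldots,k\}$ put $s_F=s_{i_1}\wedge\ldots\wedge s_{i_p}$, and let $\Lambda^p[s,\mathcal{H}]=\{\sum_{\#F=p}x_Fs_F: x_F\in\mathcal{H}\}$. For a commuting tuple $\mathbf{T}=(T_1,\ldots,T_k)$ of bounded operators on $\mathcal{H}$, let $\delta^p_{\mathbf{T}}:\Lambda^p[s,\mathcal{H}]\to\Lambda^{p+1}[s,\mathcal{H}]$, $\delta^p_{\mathbf{T}}(\sum_Fx_Fs_F)=\sum_{i=1}^k\sum_F(T_ix_F)\,s_i\wedge s_F$, for $0\le p\le k-1$; let $\delta^{-1}_{\mathbf{T}}:\{0\}\to\Lambda^0[s,\mathcal{H}]$ and $\delta^k_{\mathbf{T}}:\Lambda^k[s,\mathcal{H}]\to\{0\}$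 be the zero maps. The Koszul complex $K(\mathbf{T},\mathcal{H})$ formed by these maps is exact if the range of $\delta^{i-1}_{\mathbf{T}}$ equals $\ker\delta^i_{\mathbf{T}}$ for all $i=0,1,\ldots,k$. The Taylor spectrum is $\sigma_T(T_1,\ldots,T_k)=\{(\lambda_1,\ldots,\lambda_k)\in\mathbb{C}^k: K((T_1-\lambda_1,\ldots,T_k-\lambda_k),\mathcal{H})\text{ is not exact}\}$. *)

(* Defs.v *)
From HB Require Import structures.
From mathcomp Require Import all_boot all_order all_algebra.
From mathcomp Require Import ring.

Set Implicit Arguments.
Unset Strict Implicit.
Unset Printing Implicit Defensive.

Import Order.TTheory GRing.Theory Num.Theory.

Local Open Scope ring_scope.

Section MatrixPolynomial.
Variables (C : fieldType) (n : nat).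

Definition mxpoly_eval (P : 'M[{poly C}]_n) (l : C) : 'M[C]_n :=
  map_mx (horner_eval l) P.

Definition mxpoly_singular (P : 'M[{poly C}]_n) : Prop :=
  forall l : C, mxpoly_eval P l \notin unitmx.

(* [A i] is the coefficient of [X^i]: the indices of ['I_k] start at 0. *)
Definition mxpoly_of (k : nat) (A : 'I_k -> 'M[C]_n) : 'M[{poly C}]_n :=
  \sum_(i < k) 'X^i *: map_mx polyC (A i).

End MatrixPolynomial.

Section Exterior.
Variables (C : comNzRingType) (k : nat).

(* An element of the exterior algebra on s_0, ..., s_(k-1) is represented by  *)
(* its coordinates in the basis of the increasing products s_F.               *)
Definition ext : Type := {ffun {set 'I_k} -> C}.

HB.instance Definition _ := GRing.Lmodule.copy ext {ffun {set 'I_k} -> C^o}.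

Definition ext_basis (F : {set 'I_k}) : ext := [ffun G => (G == F)%:R].

Definition inversions (F G : {set 'I_k}) : nat :=
  #|[set ij : 'I_k * 'I_k | [&& ij.1 \in F, ij.2 \in G & (ij.2 < ij.1)%N]]|.

(* Sorting the concatenation of two disjoint increasing words F and G takes   *)
(* [inversions F G] transpositions of neighbours; overlapping words multiply  *)
(* to 0.                                                                      *)
Definition wedge (u v : ext) : ext :=
  [ffun H : {set 'I_k} => \sum_(F : {set 'I_k} | F \subset H)
     (-1) ^+ inversions F (H :\: F) * u F * v (H :\: F)].

Definition ext1 : ext := ext_basis set0.

Definition ext_gen (i : 'I_k) : ext := ext_basis [set i].

(* [enum F] lists F in increasing order. *)
Definition ext_mon (F : {set 'I_k}) : ext :=
  \big[wedge/ext1]_(i <- enum F) ext_gen i.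

Lemma inversionsUl (F G H : {set 'I_k}) : [disjoint F & G] ->
  inversions (F :|: G) H = (inversions F H + inversions G H)%N.
Proof.
move=> FG; rewrite /inversions.
set S := (X in #|pred_of_set X| = _); set S1 := (X in (#|pred_of_set X| + _)%N).
set S2 := (X in (_ + #|pred_of_set X|)%N).
have -> : S = S1 :|: S2.
  by apply/setP => -[i j]; rewrite !inE /= andb_orl.
rewrite cardsU; suff -> : S1 :&: S2 = set0 by rewrite cards0 subn0.
apply/setP => -[i j]; rewrite !inE /=.
have := disjointFr FG (x := i).
by case: (i \in F) => //= /(_ isT) ->; rewrite andbF.
Qed.

Lemma inversionsUr (F G H : {set 'I_k}) : [disjoint G & H] ->
  inversions F (G :|: H) = (inversions F G + inversions F H)%N.
Proof.
move=> GH; rewrite /inversions.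
set S := (X in #|pred_of_set X| = _); set S1 := (X in (#|pred_of_set X| + _)%N).
set S2 := (X in (_ + #|pred_of_set X|)%N).
have -> : S = S1 :|: S2.
  apply/setP => -[i j]; rewrite !inE /=.
  by case: (i \in F) => //=; rewrite andb_orl.
rewrite cardsU; suff -> : S1 :&: S2 = set0 by rewrite cards0 subn0.
apply/setP => -[i j]; rewrite !inE /=.
have := disjointFr GH (x := j).
by case: (j \in G) => [/(_ isT) ->|]; rewrite !(andbF, andFb).
Qed.

Lemma wedge_basis (F G : {set 'I_k}) :
  wedge (ext_basis F) (ext_basis G) =
  if [disjoint F & G] then (-1) ^+ inversions F G *: ext_basis (F :|: G) else 0.
Proof.
apply/ffunP => H; rewrite ffunE.
have E (F' : {set 'I_k}) : F' != F ->
    (-1) ^+ inversions F' (H :\: F') * ext_basis F F' * ext_basis G (H :\: F')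
    = 0 :> C.
  by move=> /negPf F'F; rewrite [ext_basis F _]ffunE F'F mulr0 mul0r.
case: (boolP (F \subset H)) => FH; last first.
  rewrite big1 => [|F' F'H]; last first.
    by apply: E; apply: contraNneq FH => <-.
  case: ifP => _; rewrite !ffunE //.
  suff -> : (H == F :|: G) = false by rewrite scaler0.
  by apply: contraNF FH => /eqP ->; rewrite subsetUl.
rewrite (bigD1 F) //= big1 ?addr0 => [|F' /andP[_ /E]//].
rewrite !ffunE eqxx mulr1; case: ifP => FG.
  rewrite !ffunE.
  have -> : (H == F :|: G) = (H :\: F == G).
    apply/eqP/eqP => [->|<-]; last by rewrite setDE setUIr setUCr setIT (setUidPr FH).
    by rewrite setDUl setDv set0U; apply/setDidPl; rewrite disjoint_sym.
  by case: eqP => [->|_]; rewrite ?mulr0 ?scaler0.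
rewrite ffunE; suff -> : (H :\: F == G) = false by rewrite mulr0.
apply: contraFF FG => /eqP <-.
by rewrite disjoint_sym -setI_eq0 setIDAC setDIl setDv setI0.
Qed.

Lemma wedgeA : associative wedge.
Proof.
move=> u v w; apply/ffunP => H; rewrite !ffunE.
under eq_bigr => F _ do rewrite ffunE big_distrr /=.
under [RHS]eq_bigr => F _ do rewrite ffunE big_distrr big_distrl /=.
rewrite !pair_big_dep /=.
rewrite [RHS](reindex_onto (fun p : {set 'I_k} * {set 'I_k} => (p.1 :|: p.2, p.1))
  (fun p => (p.2, p.1 :\: p.2))) /=; last first.
  move=> [E F] /= /andP[_ FE].
  by rewrite setDE setUIr setUCr setIT (setUidPr FE).
have D (F G : {set 'I_k}) : (F :|: G) :\: F = G <-> [disjoint F & G].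
  split=> [<-|FG].
    by rewrite disjoints_subset setDE setCI setCK subsetUr.
  by rewrite setDUl setDv set0U; apply/setDidPl; rewrite disjoint_sym.
apply: eq_big => -[F G] /=.
  rewrite subsetD subUset subsetUl andbT -andbA; congr (_ && _); congr (_ && _).
  rewrite disjoint_sym; apply/idP/eqP => [/D ->//|[]/D//].
case/andP=> FH; rewrite subsetD disjoint_sym => /andP[GH FG].
rewrite (D F G).2 // -setDDl.
set K := (H :\: F) :\: G.
have GK : [disjoint G & K].
  by rewrite /K disjoints_subset [_ :\: G]setDE setCI setCK subsetUr.
have -> : H :\: F = G :|: K.
  rewrite /K -{1}(setID (H :\: F) G); congr (_ :|: _).
  by apply/setIidPr; rewrite subsetD GH disjoint_sym.
rewrite inversionsUr // inversionsUl // !exprD; ring.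
Qed.

Lemma wedge1u : left_id ext1 wedge.
Proof.
move=> u; apply/ffunP => H; rewrite ffunE (bigD1 set0) ?sub0set //=.
rewrite big1 => [|F /andP[_ /negPf F0]]; last by rewrite ffunE F0 mulr0 mul0r.
rewrite ffunE eqxx mulr1 addr0 setD0 /inversions.
suff -> : [set ij : 'I_k * 'I_k | [&& ij.1 \in set0, ij.2 \in H & (ij.2 < ij.1)%N]]
    = set0 by rewrite cards0 mul1r.
by apply/setP => ij; rewrite !inE.
Qed.

Lemma wedgeu1 : right_id ext1 wedge.
Proof.
move=> u; apply/ffunP => H; rewrite ffunE (bigD1 H) //=.
rewrite big1 => [|F /andP[FH FneH]]; last first.
  rewrite [ext1 _]ffunE setD_eq0; suff -> : (H \subset F) = false by rewrite mulr0.
  by apply: contraNF FneH => HF; rewrite eqEsubset FH.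
rewrite setDv [ext1 _]ffunE eqxx mulr1 addr0 /inversions.
suff -> : [set ij : 'I_k * 'I_k | [&& ij.1 \in H, ij.2 \in set0 & (ij.2 < ij.1)%N]]
    = set0 by rewrite cards0 mul1r.
by apply/setP => ij; rewrite !inE andbF.
Qed.

Lemma inversions11 (i j : 'I_k) : inversions [set i] [set j] = (j < i)%N.
Proof.
rewrite /inversions; case: ltnP => ji.
  transitivity #|[set (i, j)]|; last by rewrite cards1.
  congr #|pred_of_set _|; apply/setP => -[a b].
  rewrite !inE /= xpair_eqE; case: eqP => //= ->; case: eqP => //= ->.
  by rewrite ji.
apply/eqP; rewrite cards_eq0; apply/eqP/setP => -[a b]; rewrite !inE /=.
by case: eqP => //= ->; case: eqP => //= ->; rewrite ltnNge ji.
Qed.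

Lemma wedge_gen_anticomm (i j : 'I_k) :
  wedge (ext_gen i) (ext_gen j) = - wedge (ext_gen j) (ext_gen i).
Proof.
rewrite /ext_gen !wedge_basis !disjoints1 !inE [j == i]eq_sym.
case: (eqVneq i j) => [_|ij] /=; first by rewrite oppr0.
rewrite !inversions11 [in RHS]setUC -scaleNr; congr (_ *: _).
have /orP[lt|lt] : (i < j)%N || (j < i)%N by rewrite -neq_ltn.
  by rewrite lt ltnNge (ltnW lt) /= expr0 expr1 opprK.
by rewrite lt ltnNge (ltnW lt) /= expr0 expr1.
Qed.

Lemma ext_monE (F : {set 'I_k}) : ext_mon F = ext_basis F.
Proof.
have srt : sorted ltn [seq val i | i <- enum F].
  rewrite (@subseq_sorted _ _ ltn_trans _ (iota 0 k)) ?iota_ltn_sorted //.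
  by rewrite -val_enum_ord map_subseq // enumT filter_subseq.
suff H (s : seq 'I_k) : sorted ltn [seq val i | i <- s] ->
    \big[wedge/ext1]_(i <- s) ext_gen i = ext_basis [set i in s].
  by rewrite /ext_mon H //; congr ext_basis; apply/setP => i; rewrite inE mem_enum.
elim: s => [|i s IH /=].
  by rewrite big_nil => *; congr ext_basis; apply/setP => i; rewrite !inE.
move=> ps; rewrite big_cons (IH (path_sorted ps)) wedge_basis disjoints1 inE.
have lt_i j : j \in s -> (i < j)%N.
  move=> js; have /allP/(_ (val j)) := order_path_min ltn_trans ps.
  by apply; apply: map_f.
case: (boolP (i \in s)) => [/lt_i|_]; first by rewrite ltnn.
suff -> : inversions [set i] [set i0 in s] = 0%N.
  rewrite /= expr0 scale1r; congr ext_basis; apply/setP => j.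
  by rewrite !inE.
apply/eqP; rewrite cards_eq0; apply/eqP/setP => -[a b]; rewrite !inE /=.
case: eqP => //= ->; case: (boolP (b \in s)) => //= /lt_i ib.
by rewrite ltnNge ltnW.
Qed.

End Exterior.

From mathcomp Require Import classical_sets.

Local Open Scope classical_set_scope.

Section Koszul.
Variables (C : fieldType) (n k : nat).

Implicit Type T : 'I_k -> 'M[C]_n.

(* [x : koszul_space p] stands for the sum of the x_F s_F over #|F| = p.      *)
(* There is no such F for p = k + 1, so [koszul_space k.+1] is the zero space *)
(* and [koszul_diff T k] the zero map.                                        *)
Definition koszul_space (p : nat) : Type :=
  {ffun {F : {set 'I_k} | #|F| == p} -> 'cV[C]_n}.

HB.instance Definition _ (p : nat) := Vector.copy (koszul_space p)
  {ffun {F : {set 'I_k} | #|F| == p} -> 'cV[C]_n}.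

(* The coordinate at s_G of the sum of the (T_i x_F) s_i /\ s_F. *)
Definition koszul_diff T (p : nat) (x : koszul_space p) : koszul_space p.+1 :=
  [ffun G => \sum_(i < k) \sum_(F : {F : {set 'I_k} | #|F| == p})
     wedge (ext_gen C i) (ext_mon C (val F)) (val G) *: (T i *m x F)].

Definition koszul_range T (p : nat) : set (koszul_space p) :=
  match p with
  | 0 => [set 0]
  | q.+1 => range (@koszul_diff T q)
  end.

Definition koszul_ker T (p : nat) : set (koszul_space p) :=
  [set x | koszul_diff T x = 0].

Definition koszul_exact T : Prop :=
  forall p : nat, (p <= k)%N -> @koszul_range T p = @koszul_ker T p.

Definition taylor_spectrum T : set 'rV[C]_k :=
  [set l | ~ koszul_exact (fun i => T i - (l 0 i)%:M)].

End Koszul.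

(* Main.v *)
(* A singular P(X) = sum_i A_i X^i has det P(X) = 0, hence P(X) v(X) = 0 for
   some nonzero polynomial vector v(X). McCoy's argument on zero divisors in
   polynomial rings, applied to a v(X) of least degree, yields a nonzero vector
   killed by every A_i; then the first Koszul map is not injective.
   Conversely, the contraction h of the Koszul complex with the vector of powers
   (1, l, l^2, ...) satisfies h d + d h = P(l), which commutes with d. If P(l)
   is invertible, the identity of the complex is therefore homotopic to 0. *)
Require Import Defs.
From mathcomp Require Import all_boot all_order all_algebra.
From mathcomp Require Import boolp classical_sets reals complex.

Set Implicit Arguments.
Unset Strict Implicit.
Unset Printing Implicit Defensive.

Import GRing.Theory.

Local Open Scope ring_scope.

(** * Common kernel vectors from polynomial null vectors *)

Section McCoy.
Variables (C : fieldType) (n k : nat) (A : 'I_k -> 'M[C]_n).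
Hypothesis commA : forall i j, comm_mx (A i) (A j).

(* v is the coefficient sequence of a polynomial vector of degree < d. If it has
   degree d - 1 and i is maximal with A_i v <> 0, the coefficient of index
   i + d - 1 of the product is A_i v_(d-1), so A_i v is a shorter nonzero
   solution. *)
Lemma mccoy_common_kernel (d : nat) (v : nat -> 'cV[C]_n) :
    (forall j, (d <= j)%N -> v j = 0) -> (exists j, v j != 0) ->
    (forall m, \sum_(i < k | (i <= m)%N) A i *m v (m - i)%N = 0) ->
  exists2 w : 'cV[C]_n, w != 0 & forall i, A i *m w = 0.
Proof.
elim: d v => [|d IH] v v_small [j vj0] vA; first by rewrite v_small ?eqxx in vj0.
case: (pselect (exists i, exists j, A i *m v j != 0)) => [[i0 ij]|noA]; last first.
  (* Here every [A i] kills every [v j], so the given nonzero one serves. *)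
  exists (v j) => // i; apply/eqP; apply: contraPT noA => Aij.
  by apply; exists i, j.
pose P (i : 'I_k) := `[< exists j, A i *m v j != 0 >].
have Pi0 : P i0 by apply/asboolP.
case: (arg_maxnP (fun i : 'I_k => val i) Pi0) => i /asboolP Pi imax.
apply: (IH (fun j => A i *m v j)) => // [l|m].
  rewrite leq_eqVlt => /predU1P[<-|/v_small->]; last exact: mulmx0.
  have := vA (i + d)%N; rewrite (bigD1 i) ?leq_addr //= addKn big1 ?addr0 //.
  (* Terms with a < i meet [v] at an index above d; those with a > i vanish by maximality of i. *)
  move=> a /andP[_ ai]; case: (ltngtP a i) => [lt|gt|/val_inj/eqP]; last 1 first.
  - by rewrite (negPf ai).
  - by rewrite v_small ?mulmx0 // ltn_subRL ltn_add2r.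
  apply/eqP; apply: contraLR gt => Aa; rewrite -leqNgt; apply: imax.
  by apply/asboolP; exists (i + d - a)%N.
transitivity (A i *m \sum_(a < k | (a <= m)%N) A a *m v (m - a)%N).
  by rewrite mulmx_sumr; apply: eq_bigr => a _; rewrite !mulmxA commA.
by rewrite vA mulmx0.
Qed.

End McCoy.

(** * Singular matrix polynomials *)

Lemma mxpoly_evalE (C : fieldType) (n k : nat) (A : 'I_k -> 'M[C]_n) (l : C) :
  mxpoly_eval (mxpoly_of A) l = \sum_(i < k) l ^+ i *: A i.
Proof.
apply/matrixP => a b; rewrite mxE !summxE raddf_sum.
by apply: eq_bigr => i _; rewrite !mxE /= horner_evalE hornerM hornerXn hornerC.
Qed.

(** The determinant commutes with evaluation, and a nonzero polynomial over an algebraically closed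
    field has a non-root. *)
Lemma mxpoly_singular_det (C : closedFieldType) (n : nat) (P : 'M[{poly C}]_n) :
  mxpoly_singular P -> \det P = 0.
Proof.
move=> sing; apply/eqP; apply: contraT => /closed_nonrootP[l].
have := sing l; rewrite unitmxE det_map_mx unitfE /= horner_evalE negbK.
by rewrite /root => ->.
Qed.

Lemma singular_common_kernel (C : closedFieldType) (n k : nat)
    (A : 'I_k -> 'M[C]_n) : (forall i j, comm_mx (A i) (A j)) ->
  mxpoly_singular (mxpoly_of A) ->
  exists2 w : 'cV[C]_n, w != 0 & forall i, A i *m w = 0.
Proof.
(* [det0P] yields a row null vector; transposing first makes it a null vector acting on the right of
   P. *)
move=> commA /mxpoly_singular_det/eqP; rewrite -det_tr => /det0P[u u0 uA].
pose v j : 'cV[C]_n := \col_a (u 0 a)`_j.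
apply: (@mccoy_common_kernel _ _ _ _ commA (\max_a size (u 0%R a)) v) => [j jd||m].
- apply/colP => a; rewrite !mxE nth_default //.
  by apply: leq_trans jd; apply: (leq_bigmax a).
- have [a ua] : exists a, u 0 a != 0.
    apply/existsP; apply: contraNT u0; rewrite negb_exists => /forallP u0.
    by apply/eqP/rowP => a; rewrite mxE; apply/eqP; rewrite -[_ == _]negbK.
  (* The index of the leading coefficient of the nonzero entry [u 0 a]. *)
  exists (size (u 0 a)).-1; apply: contraNneq ua => /colP/(_ a).
  by rewrite !mxE => /eqP; rewrite [_ == _]lead_coef_eq0.
apply/colP => a; have := congr1 (fun B : 'rV[{poly C}]_n => (B 0 a)`_m) uA.
rewrite !mxE coef0 coef_sum => <-; rewrite summxE.
rewrite (eq_bigr (fun b => \sum_(i < k | (i <= m)%N) A i a b * (u 0 b)`_(m - i))).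
  rewrite exchange_big; apply: eq_bigr => i _; rewrite mxE.
  by apply: eq_bigr => b _; rewrite mxE.
move=> b _; rewrite mxE summxE big_distrr coef_sum /= [RHS]big_mkcond /=.
apply: eq_bigr => i _; rewrite !mxE mulrCA coefXnM ltnNge.
by case: leqP => //= _; rewrite mulrC coefCM.
Qed.

(** * Creation, annihilation and the Koszul differential in all degrees at once *)

Section TotalKoszul.
Variables (C : fieldType) (n k : nat).
Implicit Types (G : {set 'I_k}) (y : {set 'I_k} -> 'cV[C]_n) (i j : 'I_k).

(** The sign of moving s_i past the generators of s_G that precede it. *)
Definition koszul_sign i G : C := (-1) ^+ #|[set j in G | (j < i)%N]|.

Lemma koszul_signU1 i j G : j \notin G ->
  koszul_sign i (j |: G) = (-1) ^+ (j < i)%N * koszul_sign i G.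
Proof.
move=> jG; rewrite /koszul_sign -exprD; congr (_ ^+ _).
rewrite (cardsD1 j) !inE eqxx /=; congr (_ + #|pred_of_set _|)%N.
by apply/setP => a; rewrite !inE; case: eqVneq => [->|]; rewrite ?(negPf jG).
Qed.

Lemma koszul_signD1 i j G : j \in G ->
  koszul_sign i (G :\ j) = (-1) ^+ (j < i)%N * koszul_sign i G.
Proof.
move=> jG; rewrite -[in RHS](finset.setD1K jG) koszul_signU1 ?setD11 // mulrA.
by rewrite -expr2 sqrr_sign mul1r.
Qed.

Lemma koszul_signK i G : koszul_sign i G * koszul_sign i G = 1.
Proof. by rewrite -expr2 sqrr_sign. Qed.

(* An element of the exterior algebra tensored with C^n is given by all its
   coordinates y G at s_G; keeping every degree avoids the dependent index
   types of koszul_space. The two operators below are the exterior product by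
   s_i on the left and the contraction with the dual of s_i. *)
Definition creation i y G : 'cV[C]_n :=
  if i \in G then koszul_sign i G *: y (G :\ i) else 0.

Definition annihilation i y G : 'cV[C]_n :=
  if i \in G then 0 else koszul_sign i G *: y (i |: G).

(** For distinct i and j in G, exactly one of the two orders picks up an extra sign; in all other
    cases both sides vanish. *)
Lemma creationC i j y G :
  creation i (creation j y) G = - creation j (creation i y) G.
Proof.
rewrite /creation; have [->|ij] := eqVneq i j.
  by rewrite setD11 scaler0; case: ifP; rewrite oppr0.
rewrite !inE [j == i]eq_sym ij /=.
case: (boolP (i \in G)) => iG; last by case: ifP => _; rewrite ?scaler0 oppr0.
case: (boolP (j \in G)) => jG; last by rewrite scaler0 oppr0.
have -> : G :\ j :\ i = G :\ i :\ j by rewrite !finset.setDDl finset.setUC.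
rewrite !scalerA !koszul_signD1 // -scaleNr; congr (_ *: _).
rewrite mulrCA [koszul_sign j G * _]mulrCA [koszul_sign j G * _]mulrC -mulNr.
congr (_ * _); case: (ltngtP i j) => [||/val_inj/eqP]; rewrite ?expr1 ?opprK //.
by rewrite (negPf ij).
Qed.

(** With [annihilation_creation_id], these are the canonical anticommutation relations. *)
Lemma annihilation_creation i j y G : i != j ->
  annihilation j (creation i y) G + creation i (annihilation j y) G = 0.
Proof.
move=> ij; rewrite /creation /annihilation !inE (negPf ij) eq_sym (negPf ij) /=.
case: (boolP (j \in G)) => jG; first by case: ifP; rewrite ?scaler0 addr0.
case: (boolP (i \in G)) => iG; last by rewrite scaler0 addr0.
have -> : (j |: G) :\ i = j |: G :\ i.
  apply/setP => a; rewrite !inE; have [->|//] := eqVneq a i.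
  by rewrite (negPf ij).
rewrite !scalerA -scalerDl koszul_signU1 // koszul_signD1 //.
rewrite mulrCA [koszul_sign i G * _]mulrCA [koszul_sign j G * _]mulrC -mulrDl.
case: (ltngtP i j) => [||/val_inj/eqP]; last by rewrite (negPf ij).
  by rewrite expr0 expr1 subrr mul0r scale0r.
by rewrite expr0 expr1 addrC subrr mul0r scale0r.
Qed.

Lemma annihilation_creation_id i y G :
  annihilation i (creation i y) G + creation i (annihilation i y) G = y G.
Proof.
rewrite /creation /annihilation !inE eqxx /=; case: ifPn => iG.
  rewrite add0r scalerA koszul_signD1 // ltnn expr0 mul1r koszul_signK scale1r.
  by rewrite finset.setD1K.
rewrite addr0 scalerA koszul_signU1 // ltnn expr0 mul1r koszul_signK scale1r.
by rewrite setU1K.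
Qed.

Lemma creation_sum i (I : finType) (M : I -> 'M[C]_n)
    (z : I -> {set 'I_k} -> 'cV[C]_n) G :
  creation i (fun F => \sum_a M a *m z a F) G
  = \sum_a M a *m creation i (z a) G.
Proof.
rewrite /creation; case: ifP => _; last by rewrite big1 // => *; rewrite mulmx0.
by rewrite scaler_sumr; apply: eq_bigr => a _; rewrite scalemxAr.
Qed.

Lemma annihilation_sum i (I : finType) (M : I -> 'M[C]_n)
    (z : I -> {set 'I_k} -> 'cV[C]_n) G :
  annihilation i (fun F => \sum_a M a *m z a F) G
  = \sum_a M a *m annihilation i (z a) G.
Proof.
rewrite /annihilation; case: ifP => _.
  by rewrite big1 // => *; rewrite mulmx0.
by rewrite scaler_sumr; apply: eq_bigr => a _; rewrite scalemxAr.
Qed.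

Variable T : 'I_k -> 'M[C]_n.
Hypothesis commT : forall i j, comm_mx (T i) (T j).

Definition koszul_total y G : 'cV[C]_n := \sum_i T i *m creation i y G.

(** Contraction with the covector c. The weights are scalar matrices so that [creation_sum]
    applies. *)
Definition koszul_homotopy (c : 'I_k -> C) y G : 'cV[C]_n :=
  \sum_i (c i)%:M *m annihilation i y G.

Lemma eq_koszul_total y z : y =1 z -> koszul_total y =1 koszul_total z.
Proof.
by move=> yz G; apply: eq_bigr => i _; rewrite /creation yz.
Qed.

Lemma koszul_total_mul (M : 'M[C]_n) y G : (forall i, comm_mx M (T i)) ->
  koszul_total (fun F => M *m y F) G = M *m koszul_total y G.
Proof.
move=> commM; rewrite mulmx_sumr; apply: eq_bigr => i _; rewrite /creation.
by case: ifP => _; rewrite ?mulmx0 // -!scalemxAr !mulmxA commM.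
Qed.

(** The terms at (i, j) and (j, i) cancel: the matrices commute and the creations anticommute. *)
Lemma koszul_total_sqr y G : koszul_total (koszul_total y) G = 0.
Proof.
rewrite /koszul_total; under eq_bigr => i _ do rewrite creation_sum mulmx_sumr.
rewrite pair_big /=.
pose f p := T p.1 *m (T p.2 *m creation p.1 (creation p.2 y) G).
have fC (p : 'I_k * 'I_k) : f (p.2, p.1) = - f p.
  by rewrite /f /= !mulmxA commT creationC mulmxN.
(* In characteristic 2, antisymmetry does not kill the diagonal terms, hence a direct argument. *)
have f0 (p : 'I_k * 'I_k) : p.1 = p.2 -> f p = 0.
  case: p => i j /= <-; rewrite /f /creation /=.
  by rewrite setD11 scaler0; case: ifP; rewrite !mulmx0.
rewrite -[LHS]/(\sum_p f p) (bigID (fun p : 'I_k * 'I_k => (p.1 < p.2)%N)) /=.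
rewrite [X in _ + X](bigID (fun p : 'I_k * 'I_k => p.1 == p.2)) /=.
rewrite [X in _ + (X + _)]big1 ?add0r => [|p /andP[_ /eqP/f0//]].
have swapK : involutive (fun p : 'I_k * 'I_k => (p.2, p.1)) by case.
rewrite [X in _ + X](reindex_inj (inv_inj swapK)) /=.
rewrite [X in _ + X](eq_bigl (fun p : 'I_k * 'I_k => (p.1 < p.2)%N)); last first.
  by move=> p /=; rewrite -leqNgt -(inj_eq val_inj) eq_sym ltn_neqAle andbC.
by rewrite -big_split big1 // => p _ /=; rewrite fC subrr.
Qed.

(** By the anticommutation relations only the diagonal terms [c i *: T i] survive. *)
Lemma koszul_homotopyE c y G :
  koszul_homotopy c (koszul_total y) G + koszul_total (koszul_homotopy c y) G
  = (\sum_i c i *: T i) *m y G.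
Proof.
rewrite /koszul_homotopy /koszul_total.
under eq_bigr => j _ do rewrite annihilation_sum mulmx_sumr.
under [X in _ + X]eq_bigr => i _ do rewrite creation_sum mulmx_sumr.
rewrite exchange_big -big_split mulmx_suml; apply: eq_bigr => i _.
rewrite -big_split (bigD1 i) //= big1 => [|j ji]; rewrite !mul_scalar_mx -scalemxAr.
  by rewrite addr0 -scalerDr -mulmxDr annihilation_creation_id scalemxAl.
by rewrite -scalerDr -mulmxDr annihilation_creation ?mulmx0 ?scaler0 // eq_sym.
Qed.

End TotalKoszul.

(** * Coordinates of a generator times a monomial *)

Lemma inversions1s (k : nat) (i : 'I_k) (F : {set 'I_k}) :
  inversions [set i] F = #|[set j in F | (j < i)%N]|.
Proof.
have inj : injective (pair i : 'I_k -> 'I_k * 'I_k) by move=> a b [].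
rewrite -(card_imset _ inj) /inversions; congr #|pred_of_set _|.
apply/setP => -[a b]; rewrite !inE /=; apply/idP/imsetP => [|[c]].
  by move=> /and3P[/eqP-> bF ba]; exists b; rewrite ?inE ?bF.
by rewrite inE => /andP[cF ci] [-> ->]; rewrite eqxx cF.
Qed.

Lemma wedge_gen_mon (C : comNzRingType) (k : nat) (i : 'I_k) (F G : {set 'I_k}) :
  wedge (ext_gen C i) (ext_mon C F) G =
  if (i \in G) && (F == G :\ i) then (-1) ^+ #|[set j in F | (j < i)%N]| else 0.
Proof.
rewrite ext_monE wedge_basis disjoints1; case: ifPn => iF; last first.
  rewrite ffunE; case: ifP => // /andP[_ /eqP FG].
  by rewrite FG setD11 in iF.
rewrite !ffunE inversions1s; have -> : (G == i |: F) = (i \in G) && (F == G :\ i).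
  apply/eqP/andP => [->|[iG /eqP->]]; last by rewrite finset.setD1K.
  by rewrite setU11 setU1K.
by case: ifP => _; rewrite ?scaler0 // /GRing.scale /= mulr1.
Qed.

(** * Exactness of the graded Koszul complex *)

Section Koszul.
Variables (C : fieldType) (n k : nat).
Implicit Type (T : 'I_k -> 'M[C]_n).

(** Extension by zero carries the graded complex into the setting of all degrees. *)
Definition koszul_lift p (x : koszul_space C n k p) (F : {set 'I_k}) : 'cV[C]_n :=
  if insub F is Some u then x u else 0.

Definition koszul_res p (y : {set 'I_k} -> 'cV[C]_n) : koszul_space C n k p :=
  [ffun F => y (val F)].

Lemma koszul_lift_val p (x : koszul_space C n k p) F : koszul_lift x (val F) = x F.
Proof. by rewrite /koszul_lift valK. Qed.

Lemma koszul_lift_out p (x : koszul_space C n k p) (F : {set 'I_k}) :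
  #|F| != p -> koszul_lift x F = 0.
Proof. by move=> Fp; rewrite /koszul_lift insubN. Qed.

Lemma koszul_diffE T p (x : koszul_space C n k p) G :
  koszul_diff T x G = koszul_total T (koszul_lift x) (val G).
Proof.
rewrite ffunE; apply: eq_bigr => i _; rewrite /creation.
case: ifP => iG; last first.
  by rewrite mulmx0 big1 // => F _; rewrite wedge_gen_mon iG scale0r.
have pG : #|val G :\ i| == p.
  by have := valP G; rewrite (cardsD1 i (val G)) iG.
rewrite (bigD1 (exist _ (val G :\ i) pG : {F : {set 'I_k} | #|F| == p})) //=.
rewrite big1 => [|F neF]; last first.
  by rewrite wedge_gen_mon iG (_ : _ == _ = false) ?scale0r //; apply: negbTE.
rewrite addr0 wedge_gen_mon iG eqxx -(koszul_lift_val x) /= scalemxAr.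
congr (_ *m (_ *: _)).
(* One sign counts in G without i, the other in G; i is not below itself. *)
congr (_ ^+ #|pred_of_set _|); apply/setP => a; rewrite !inE.
by case: eqVneq => [->|]; rewrite ?ltnn ?andbF.
Qed.

Lemma koszul_lift_diff T p (x : koszul_space C n k p) :
  koszul_lift (koszul_diff T x) =1 koszul_total T (koszul_lift x).
Proof.
move=> F; have [Fp|Fp] := boolP (#|F| == p.+1).
  pose G : {F : {set 'I_k} | #|F| == p.+1} := exist _ F Fp.
  by rewrite -[F in LHS]/(val G) koszul_lift_val koszul_diffE.
rewrite koszul_lift_out // [RHS]big1 // => i _; rewrite /creation.
case: ifP => iF; last by rewrite mulmx0.
rewrite koszul_lift_out ?scaler0 ?mulmx0 //.
by apply: contra Fp; rewrite (cardsD1 i F) iF.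
Qed.

Lemma koszul_diff_sqr T p (x : koszul_space C n k p) :
  (forall i j, comm_mx (T i) (T j)) -> koszul_diff T (koszul_diff T x) = 0.
Proof.
move=> commT; apply/ffunP => G.
rewrite koszul_diffE (eq_koszul_total _ (koszul_lift_diff T x)).
by rewrite koszul_total_sqr // ffunE.
Qed.

(** If d x = 0 then P x = d h x; as the inverse of P commutes with d, x is the image under d of that
    inverse applied to h x. *)
Lemma nonsingular_koszul_exact T (c : 'I_k -> C) :
    (forall i j, comm_mx (T i) (T j)) -> \sum_i c i *: T i \in unitmx ->
  koszul_exact T.
Proof.
move=> commT; set P := \sum_i _ => uP p _; apply/seteqP; split.
  case: p => [|p] x /=.
    move=> ->; apply/ffunP => G; rewrite koszul_diffE [LHS]big1 ?ffunE // => i _.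
    rewrite /creation /koszul_lift; case: ifP => _; last exact: mulmx0.
    by case: insub => [a|]; rewrite ?ffunE scaler0 mulmx0.
  by case=> y _ <-; apply: koszul_diff_sqr.
move=> x /= Dx0.
have commP i : comm_mx P (T i).
  rewrite /comm_mx mulmx_suml mulmx_sumr; apply: eq_bigr => j _.
  by rewrite -scalemxAl -scalemxAr commT.
have commV i : comm_mx (invmx P) (T i).
  rewrite /comm_mx -[in LHS](mulmxK uP (T i)) -commP.
  by rewrite !mulmxA mulVmx // mul1mx.
have D0 : koszul_total T (koszul_lift x) =1 (fun=> 0).
  move=> G; rewrite -koszul_lift_diff Dx0 /koszul_lift.
  by case: insub => [a|] //; rewrite ffunE.
pose h := koszul_homotopy c (koszul_lift x).
have Dh G : koszul_total T (fun F => invmx P *m h F) G = koszul_lift x G.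
  rewrite koszul_total_mul // -[RHS](mulKmx uP) -koszul_homotopyE.
  congr (_ *m _); rewrite -[LHS]add0r; congr (_ + _).
  rewrite /koszul_homotopy big1 // => i _; rewrite /annihilation D0.
  by case: ifP; rewrite ?scaler0 mulmx0.
(* Contraction lowers the degree by one. The successor form also covers p = 0, where [h] vanishes
   everywhere and so x = 0. *)
have h_out (G : {set _}) : #|G|.+1 != p -> h G = 0.
  move=> Gp; rewrite /h /koszul_homotopy big1 // => i _; rewrite /annihilation.
  case: ifPn => iG; first by rewrite mulmx0.
  by rewrite koszul_lift_out ?scaler0 ?mulmx0 // cardsU1 iG.
case: p x {Dx0 D0} @h Dh h_out => [|p] x h Dh h_out.
  apply/ffunP => G; rewrite -koszul_lift_val -Dh ffunE [LHS]big1 // => i _.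
  by rewrite /creation; case: ifP => _; rewrite ?h_out ?mulmx0 ?scaler0 ?mulmx0.
exists (koszul_res p (fun F => invmx P *m h F)) => //.
apply/ffunP => G; rewrite koszul_diffE -[RHS]koszul_lift_val -Dh.
apply: eq_koszul_total => F; rewrite /koszul_lift.
case: insubP => [a _ <-|Fp]; first by rewrite ffunE.
by rewrite h_out ?mulmx0.
Qed.

(** Placed at the empty monomial, w is a nonzero cycle of degree 0, where the range is zero. *)
Lemma common_kernel_not_exact T (w : 'cV[C]_n) :
  w != 0 -> (forall i, T i *m w = 0) -> ~ koszul_exact T.
Proof.
move=> w0 Tw exactT; pose x := koszul_res 0 (fun=> w).
have : koszul_ker T x.
  apply/ffunP => G; rewrite koszul_diffE ffunE [LHS]big1 // => i _.
  rewrite /creation /koszul_lift; case: ifP => _; last exact: mulmx0.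
  by case: insub => [a|]; rewrite ?ffunE -scalemxAr ?Tw ?mulmx0 scaler0.
rewrite -exactT // => /ffunP.
have p0 : #|finset.set0 : {set 'I_k}| == 0 by rewrite cards0.
by move=> /(_ (exist _ finset.set0 p0)); rewrite !ffunE; apply/eqP.
Qed.

End Koszul.

Theorem theorem3p2 (R : realType) (n k : nat) (A : 'I_k -> 'M[R[i]]_n)
    (hA : forall i j : 'I_k, comm_mx (A i) (A j)) :
  mxpoly_singular (mxpoly_of A) <-> taylor_spectrum A (0 : 'rV[R[i]]_k).
Proof.
rewrite /taylor_spectrum /=.
have -> : (fun i => A i - ((0 : 'rV[R[i]]_k) ord0 i)%:M) = A.
  by apply/funext => i; rewrite mxE raddf0 subr0.
split=> [/(singular_common_kernel hA)[w w0 Aw]|nexact l].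
  exact: common_kernel_not_exact w0 Aw.
(* The powers of l become the covector c of the contraction. *)
apply/negP; rewrite mxpoly_evalE => uP.
by apply: nexact; apply: nonsingular_koszul_exact hA uP.
Qed.
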